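(* Let $X,Y$ be Banach spaces, $U\subset X$ open, $f\colon U\to Y$ twice continuously differentiable, and let $x_0\in U$ be such that $D:=df(x_0)\colon X\to Y$ is surjective and has a bounded linear right inverse $Q\colon Y\to X$. Let $\delta,c,c_2>0$ be constants such that $\|Q\|\le c$, $B_\delta(x_0;X)\subset U$, and $$\|df(x)-D\|\le\tfrac{1}{4c}\quad\text{and}\quad \|d^2f(x)\|\le c_2\qquad\text{for all }x\in B_\delta(x_0;X).$$ Put $\hat\delta:=\min\{\delta,\frac{1}{4cc_2}\}\in(0,1)$. Let $\mathcal{N}=\mathcal{N}^f_{x_0,Q}\colon U_0(\delta)\to X$ be the Newton-Picard map. Then, given $W_1=(x_1,\xi_1)\in TU_0(\delta)=U_0(\delta)\times X$, there is a constant $C$ depending on $\|\xi_1\|_X$ and $\|d\mathcal{N}|_{x_0}\|$ such that $$\|T\mathcal{N}(W_1)-W_1\|_{TX}\le C\,\|Tf(W_1)\|_{TY}\bigl(1+\|Tf(W_1)\|_{TY}\bigr).$$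
   Context: Let $U_0(\delta)=\{x_1\in B_{\delta/8}(x_0;X)\mid \|f(x_1)\|_Y<\frac{\delta}{4c}\}$, an open set. For each $x_1\in U_0(\delta)$ there is (known result of McDuff and Salamon) a unique $x\in X$ with $f(x)=0$, $x-x_1\in\operatorname{im}Q$ and $\|x-x_0\|<\delta$, and it satisfies $\|x-x_1\|\le 2c\|f(x_1)\|$; the Newton-Picard map is $\mathcal{N}\colon U_0(\delta)\to X$, $x_1\mapsto x$. It is continuously differentiable. The differential of $\mathcal N$ at the initial point $x_0$ is taken to be $d\mathcal{N}|_{x_0}=\mathrm{Id}-QD$. Tangent maps: $T\mathcal{N}(x_1,\xi_1)=(\mathcal{N}(x_1),d\mathcal{N}|_{x_1}\xi_1)\in TX=X\oplus X$ and $Tf(x_1,\xi_1)=(f(x_1),df|_{x_1}\xi_1)\in TY=Y\oplus Y$. The spaces $X\oplus X$ and $Y\oplus Y$ carry a product norm, e.g. $\|(a,b)\|=\max\{\|a\|,\|b\|\}$. *)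

(* Defs.v *)
From HB Require Import structures.
From mathcomp Require Import all_boot all_order all_algebra.
From mathcomp Require Import all_classical all_reals.
From mathcomp Require Import topology normedtype derive.

Set Implicit Arguments.
Unset Strict Implicit.
Unset Printing Implicit Defensive.

Import Order.TTheory GRing.Theory Num.Theory.
Import numFieldNormedType.Exports.

Local Open Scope classical_set_scope.
Local Open Scope ring_scope.

(* The library has no normed space of bounded linear operators: it is built
   here, so that second derivatives are derivatives of an operator-valued map. *)
Section BoundedLinear.
Context {R : realType} {X Y : normedModType R}.

(* [sup] is 0 on unbounded sets, so this is the operator norm only for
   continuous linear T. *)
Definition opnorm (T : X -> Y) : R :=
  sup [set `|T x| | x in [set x : X | `|x| <= 1]].

Definition blin_pred : {pred X -> Y} :=
  mem [set T : X -> Y | linear T /\ continuous T].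

Record blin :=
  BLin { blin_fun :> X -> Y ; blin_subproof : blin_fun \in blin_pred }.

HB.instance Definition _ := [isSub for blin_fun].
HB.instance Definition _ := [Choice of blin by <:].

Lemma blin_linear (T : blin) : linear T.
Proof. by have /set_mem[] := blin_subproof T. Qed.

Lemma blin_continuous (T : blin) : continuous T.
Proof. by have /set_mem[] := blin_subproof T. Qed.

HB.instance Definition _ (T : blin) :=
  GRing.isLinear.Build R X Y *:%R (blin_fun T) (blin_linear T).

Lemma blin_submod_closed : submod_closed blin_pred.
Proof.
split=> [|a S T /set_mem[Sl Sc] /set_mem[Tl Tc]]; apply/mem_set; split.
- by move=> k x y; rewrite /= scaler0 addr0.
- by move=> x; exact: cst_continuous.
- move=> k x y; rewrite !fctE Sl Tl !scalerDr !scalerA (mulrC a k).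
  by rewrite addrACA.
- move=> x; apply: cvgD; last exact: Tc.
  by apply: cvgZl_tmp; exact: Sc.
Qed.

HB.instance Definition _ :=
  GRing.isSubmodClosed.Build R (X -> Y) blin_pred blin_submod_closed.
HB.instance Definition _ := [SubChoice_isSubLmodule of blin by <:].

Lemma opnorm_has_sup (T : blin) :
  has_sup [set `|T x| | x in [set x : X | `|x| <= 1]].
Proof.
split; first by exists `|T 0|; exists 0 => //=; rewrite normr0.
have /continuous_linear_bounded/bounded_funP/(_ 1)[M TM] :=
  @blin_continuous T 0.
by exists M => _ [x x1 <-]; exact: TM.
Qed.

Lemma opnorm_ub (T : blin) (x : X) : `|T x| <= opnorm T * `|x|.
Proof.
have [->|x0] := eqVneq x 0; first by rewrite linear0 !normr0 mulr0.
rewrite -ler_pdivrMr ?normr_gt0// mulrC.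
have -> : `|x|^-1 * `|T x| = `|T (`|x|^-1 *: x)|.
  by rewrite linearZ normrZ ger0_norm ?invr_ge0.
apply: ub_le_sup; first by case: (opnorm_has_sup T).
exists (`|x|^-1 *: x) => //=.
by rewrite normrZ ger0_norm ?invr_ge0// mulVf ?normr_eq0.
Qed.

Lemma opnorm_le (T : blin) (M : R) :
  (forall x, `|x| <= 1 -> `|T x| <= M) -> opnorm T <= M.
Proof.
move=> TM; apply: ge_sup; first by case: (opnorm_has_sup T).
by move=> _ [x x1 <-]; exact: TM.
Qed.

Lemma opnorm_ge0 (T : blin) : 0 <= opnorm T.
Proof.
apply: ub_le_sup; first by case: (opnorm_has_sup T).
by exists 0; rewrite /= ?normr0 ?linear0 ?normr0.
Qed.

Let opnormD (S T : blin) : opnorm (S + T : blin) <= opnorm S + opnorm T.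
Proof.
apply: opnorm_le => x x1.
rewrite (le_trans (ler_normD _ _))// lerD//.
- by rewrite (le_trans (opnorm_ub S x))// ler_piMr ?opnorm_ge0.
- by rewrite (le_trans (opnorm_ub T x))// ler_piMr ?opnorm_ge0.
Qed.

Let opnormZ_le (a : R) (T : blin) : opnorm (a *: T : blin) <= `|a| * opnorm T.
Proof.
apply: opnorm_le => x x1; rewrite [(a *: T : blin) x]/(a *: T x) normrZ ler_wpM2l//.
by rewrite (le_trans (opnorm_ub T x))// ler_piMr ?opnorm_ge0.
Qed.

Let opnormZ (a : R) (T : blin) : opnorm (a *: T : blin) = `|a| * opnorm T.
Proof.
apply/eqP; rewrite eq_le opnormZ_le andTb.
have [->|a0] := eqVneq a 0; first by rewrite normr0 mul0r; exact: opnorm_ge0.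
rewrite -ler_pdivlMl ?normr_gt0// -normfV.
by apply: le_trans (opnormZ_le _ _); rewrite scalerA mulVf// scale1r.
Qed.

Let opnorm_eq0 (T : blin) : opnorm T = 0 -> T = 0.
Proof.
move=> T0; apply/val_inj/funext => x; apply/eqP; rewrite -normr_le0.
by rewrite (le_trans (opnorm_ub T x))// T0 mul0r.
Qed.

HB.instance Definition _ :=
  Lmodule_isNormed.Build R blin opnormD opnormZ opnorm_eq0.

Lemma blin_normE (T : blin) : `|T| = opnorm T.
Proof. by []. Qed.

End BoundedLinear.

Arguments blin {R} X Y.

Section Differentials.
Context {R : realType}.

(* Defined at every point; the value is 0 where 'd f x is not continuous. *)
Definition bdiff {X Y : normedModType R} (f : X -> Y) (x : X) : blin X Y :=
  insubd (0 : blin X Y) ('d f x : X -> Y).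

Lemma bdiffE {X Y : normedModType R} (f : X -> Y) (x : X) :
  differentiable f x -> bdiff f x = 'd f x :> (X -> Y).
Proof.
move=> fx; apply: insubdK; apply/mem_set; split; first exact: linearP.
exact: diff_continuous.
Qed.

Definition C2_on {X Y : normedModType R} (U : set X) (f : X -> Y) : Prop :=
  [/\ forall x, U x -> differentiable f x,
      forall x, U x -> differentiable (bdiff f) x &
      forall x, U x -> {for x, continuous (bdiff (bdiff f))}].

Definition tangent_map {X Y : normedModType R} (g : X -> Y) (W : X * X) : Y * Y :=
  (g W.1, 'd g (W.1) W.2).

End Differentials.

Section NewtonPicard.
Context {R : realType} {X Y : normedModType R}.

Definition newton_dom (f : X -> Y) (x0 : X) (c delta : R) : set X :=
  ball x0 (delta / 8) `&` [set x1 | `|f x1| < delta / (4 * c)].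

(* The unique zero of f in the delta-ball around x0 that differs from x1 by an
   element of im Q; the default value x1 is used only when there is none. *)
Definition newton_picard (f : X -> Y) (x0 : X) (Q : blin Y X) (delta : R)
    (x1 : X) : X :=
  xget x1 [set x | [/\ f x = 0, range Q (x - x1) & `|x - x0| < delta]].

(* Id - QD, by convention the differential of the Newton-Picard map at the
   initial point x0, which need not be a zero of f nor lie in the domain. *)
Definition newton_picard_diff0 (f : X -> Y) (x0 : X) (Q : blin Y X) : X -> X :=
  fun xi => xi - Q ('d f x0 xi).

End NewtonPicard.

(* Main.v *)
Require Import Defs.
From HB Require Import structures.
From mathcomp Require Import all_boot all_order all_algebra.
From mathcomp Require Import all_classical all_reals.
From mathcomp Require Import topology normedtype derive.
From mathcomp Require Import landau sequences interval_inference.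
From mathcomp Require Import ring lra.

Set Implicit Arguments.
Unset Strict Implicit.
Unset Printing Implicit Defensive.

Import Order.TTheory GRing.Theory Num.Theory.
Import numFieldNormedType.Exports.

Local Open Scope classical_set_scope.
Local Open Scope ring_scope.

(** Write N for the Newton-Picard map, A for the differential of f at N(x1), and
    D for the differential of f at x0.  On the delta-ball df is within 1/(4c) of
    D, so f is an affine map with linear part D up to an error that is
    1/(4c)-Lipschitz ([almost_linear]).  As D Q = Id and |Q| <= c, the map
    y |-> f (x1 + Q y) is the identity of Y, plus a constant, plus a
    1/4-Lipschitz error.  Hence it has a zero ([newton_zero]), and increments
    along im Q are controlled by increments of f ([image_displacement]), which
    gives |N(x1) - x1| <= 2c |f(x1)| and the Lipschitz continuity of N.

    The equation f(N(x1)) = 0 can then be differentiated.  The operator A Q is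
    within 1/4 of the identity, so it has an inverse S of norm at most 2, and
      dN(x1) xi = xi - Q S A xi  ([newton_picard_differential]).
    Since A = df(N(x1)) and |d^2 f| <= c2, the mean value inequality yields
      |A xi| <= |df(x1) xi| + c2 |N(x1) - x1| |xi|,
    and therefore
      |dN(x1) xi - xi| <= 2c (|df(x1) xi| + 2 c c2 |xi| |f(x1)|).
    Both components of TN(W1) - W1 are thus bounded by
    2c (1 + 2 c c2 |xi|) |Tf(W1)|. *)

(** * Differentials, the mean value inequality and fixed points *)

Section Expansion.
Context {R : realType} {V W : normedModType R}.

(** The epsilon-delta form of the little-o in the definition of the
    differential; the next lemma is the converse. *)
Lemma diff_expansion (f : V -> W) (x : V) (e : R) :
  differentiable f x -> 0 < e ->
  exists2 d, 0 < d &
    forall h, `|h| < d -> `|f (x + h) - f x - 'd f x h| <= e * `|h|.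
Proof.
move=> /diff_locally/eqaddoP fx e0.
have /nbhs_normP[d /= d0 dP] := fx e e0.
exists d => // h hd; have := dP h; rewrite /= ?sub0r normrN => /(_ hd).
by rewrite [x + h]addrC -addrA -opprD.
Qed.

Lemma expansion_diff (f : V -> W) (x : V) (df : blin V W) :
  (forall e, 0 < e -> exists2 d, 0 < d &
    forall h, `|h| < d -> `|f (x + h) - f x - df h| <= e * `|h|) ->
  'd f x = df :> (V -> W).
Proof.
move=> fx; apply: diff_unique; first exact: blin_continuous.
apply/eqaddoP => e e0; have [d d0 dP] := fx e e0.
apply/nbhs_normP; exists d => //= h /=; rewrite sub0r normrN => /dP.
by rewrite [x + h]addrC -addrA -opprD.
Qed.

Lemma bounded_linear_blin (g : V -> W) (M : R) :
  linear g -> (forall x, `|g x| <= M * `|x|) ->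
  exists T : blin V W, T = g :> (V -> W).
Proof.
move=> glin gM.
pose g' : {linear V -> W} := HB.pack g (GRing.isLinear.Build R V W *:%R g glin).
have gc : continuous g'.
  apply: bounded_linear_continuous; apply/bounded_funP => r.
  exists (`|M| * r) => x xr; rewrite (le_trans (gM x))//.
  by rewrite (le_trans (ler_norm _))// normrM normr_id ler_wpM2l.
have gP : g \in (@blin_pred R V W) by apply/mem_set; split.
by exists (BLin gP).
Qed.

End Expansion.

(** The argument for the mean value inequality in a normed space: the set of the
    times up to which the bound on phi t - phi 0 holds has a supremum, the local
    estimate at this supremum carries the bound past it, hence the supremum
    is 1. *)
Lemma local_lipschitz_unit_itv (R : realType) (V : normedModType R)
    (phi : R -> V) (K : R) :
  (forall t, 0 <= t <= 1 -> exists2 e, 0 < e &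
     forall s, 0 <= s <= 1 -> `|s - t| < e ->
       `|phi s - phi t| <= K * `|s - t|) ->
  `|phi 1 - phi 0| <= K.
Proof.
move=> loc.
pose A := [set t : R | 0 <= t <= 1 /\
  forall s, 0 <= s <= t -> `|phi s - phi 0| <= K * s].
have A0 : A 0.
  split=> [|s]; first by rewrite lexx ler01.
  by rewrite -eq_le => /eqP <-; rewrite subrr normr0 mulr0.
have supA : has_sup A by split; [exists 0|exists 1 => t [/andP[]]].
have Aub t : A t -> t <= sup A by move=> At; apply: ub_le_sup => //; case: supA.
set b := sup A in Aub.
have b01 : 0 <= b <= 1.
  by rewrite Aub// ge_sup//; [exists 0|move=> t [/andP[]]].
have [e e0 bP] := loc b b01.
have [t At tb] := sup_adherent e0 supA; rewrite -/b in tb.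
have tleb := Aub _ At; have [/andP[t0 t1] tP] := At.
(* Between b and b + e the bound goes through t in A: t <= b <= s, so the
   lengths t, b - t and s - b add up to s. *)
have bound s : 0 <= s <= 1 -> s < b + e -> `|phi s - phi 0| <= K * s.
  move=> /andP[s0 s1] se; have [sb|bs] := ltP s b.
    have [u [_ uP] su] := sup_gt (ex_intro _ 0 A0) sb.
    by apply: uP; rewrite s0 ltW.
  have ht : `|phi t - phi 0| <= K * t by apply: tP; rewrite t0 lexx.
  have htb : `|phi t - phi b| <= K * (b - t).
    have tE : `|t - b| = b - t by rewrite distrC ger0_norm// subr_ge0.
    by rewrite -tE bP ?t0// tE; lra.
  have hbs : `|phi s - phi b| <= K * (s - b).
    have sE : `|s - b| = s - b by rewrite ger0_norm// subr_ge0.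
    by rewrite -sE bP ?s0// sE; lra.
  have -> : phi s - phi 0 =
      (phi s - phi b) - (phi t - phi b) + (phi t - phi 0).
    by rewrite opprB !addrA !subrK.
  rewrite (le_trans (ler_normD _ _))// (le_trans (lerD (ler_normB _ _) ht))//.
  by rewrite (le_trans (lerD (lerD hbs htb) (lexx _)))//; nra.
have b1 : b = 1.
  apply/eqP; rewrite eq_le; have /andP[b0 ->] := b01; rewrite /= leNgt.
  apply/negP => blt1.
  suff /Aub : A (Num.min 1 (b + e / 2)) by rewrite ge_min; lra.
  split=> [|s /andP[s0]]; first by rewrite le_min ge_min; lra.
  by rewrite le_min => /andP[s1 sb]; apply: bound; [rewrite s0|lra].
by rewrite -[leRHS]mulr1; apply: bound; rewrite ?b1; lra.
Qed.

(** Comparison with an arbitrary linear map L serves twice: L = D measures how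
    far f is from being affine, and L = 0 is the usual inequality, applied
    to df. *)
Lemma diff_mean_value (R : realType) (V W : normedModType R) (f : V -> W)
    (L : {linear V -> W}) (a b : V) (M : R) :
  (forall t, 0 <= t <= 1 -> differentiable f (a + t *: (b - a)) /\
     forall v, `|'d f (a + t *: (b - a)) v - L v| <= M * `|v|) ->
  `|f b - f a - L (b - a)| <= M * `|b - a|.
Proof.
move=> fP; rewrite -[f b](congr1 f (subrKC a b)).
move: (b - a) fP => w fP; apply/ler_addgt0Pr => e e0.
pose phi t := f (a + t *: w) - t *: L w.
have phi10 : phi 1 - phi 0 = f (a + w) - f a - L w.
  by rewrite /phi !scale1r !scale0r subr0 addr0 addrAC.
rewrite -phi10; apply: local_lipschitz_unit_itv => t t01.
have [ft Mt] := fP t t01.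
(* The denominator |w| + 1 instead of |w| covers the case w = 0. *)
have e'0 : 0 < e / (`|w| + 1) by rewrite divr_gt0// ltr_wpDl.
have [d d0 dP] := diff_expansion ft e'0.
exists (d / (`|w| + 1)); first by rewrite divr_gt0// ltr_wpDl.
move=> s s01 std.
have hsd : `|(s - t) *: w| < d.
  rewrite normrZ; rewrite ltr_pdivlMr in std; last by rewrite ltr_wpDl.
  by apply: le_lt_trans std; rewrite ler_wpM2l// lerDl.
have ptE : a + t *: w + (s - t) *: w = a + s *: w.
  by rewrite -addrA -scalerDl (addrC t) subrK.
have := dP _ hsd; rewrite ptE => step.
have -> : phi s - phi t =
    (f (a + s *: w) - f (a + t *: w) - 'd f (a + t *: w) ((s - t) *: w)) +
    (s - t) *: ('d f (a + t *: w) w - L w).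
  rewrite linearZ /= [in RHS]scalerBr [in RHS]addrA [in RHS]subrK /phi.
  by rewrite scalerBl !opprD !opprK addrACA.
rewrite (le_trans (ler_normD _ _))// (le_trans (lerD step (lexx _)))// !normrZ.
have st0 : 0 <= `|s - t| by [].
have := ler_wpM2l st0 (Mt w).
have : e / (`|w| + 1) * `|w| <= e.
  by rewrite mulrAC ler_pdivrMr ?ltr_wpDl// ler_wpM2l ?lerDl// ltW.
move=> /(ler_wpM2l st0); rewrite mulrCA [_ * `|w|]mulrC; nra.
Qed.

Lemma contraction_closed_ball (R : realType) (Y : completeNormedModType R)
    (T : Y -> Y) (r q : R) : 0 <= r -> 0 <= q -> q < 1 ->
  (forall y, `|y| <= r -> `|T y| <= r) ->
  (forall y z, `|y| <= r -> `|z| <= r -> `|T y - T z| <= q * `|y - z|) ->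
  exists2 y, `|y| <= r & T y = y.
Proof.
move=> r0 q0 q1 Tr Tq.
pose A : set Y := closed_ball_ Num.norm 0 r.
have AE y : A y = (`|y| <= r) :> Prop by rewrite /A/closed_ball_/= sub0r normrN.
have funT : set_fun A A T by move=> y; rewrite !AE; exact: Tr.
pose T' : {fun A >-> A} := HB.pack T (isFun.Build _ _ A A T funT).
have ctr : is_contraction T'.
  exists (NngNum q0); split => //= -[y z] /= [].
  by rewrite !AE; exact: Tq.
have [||y] := banach_fixed_point ctr.
- exact: closed_closed_ball_.
- by exists 0; rewrite AE normr0.
- by rewrite AE => yr Ty; exists y.
Qed.

(** The equation B y = z says that y is a fixed point of y |-> y - B y + z, a
    q-contraction of the ball of radius |z| / (1 - q).  The bound on the inverse
    comes from (1 - q) |y| <= |B y|, which also gives injectivity, hence the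
    linearity of the inverse. *)
Lemma near_identity_inverse (R : realType) (Y : completeNormedModType R)
    (B : Y -> Y) (q : R) : linear B -> 0 <= q -> q < 1 ->
  (forall y, `|y - B y| <= q * `|y|) ->
  exists S : blin Y Y, [/\ forall y, B (S y) = y, forall y, S (B y) = y &
    forall y, `|S y| <= (1 - q)^-1 * `|y|].
Proof.
move=> Blin q0 q1 Bq.
pose B' : {linear Y -> Y} := HB.pack B (GRing.isLinear.Build R Y Y *:%R B Blin).
have BB y z : B (y - z) = B y - B z by exact: (linearB B').
have q1' : 0 < 1 - q by rewrite subr_gt0.
have lower y : `|y| <= (1 - q)^-1 * `|B y|.
  rewrite ler_pdivlMl// mulrBl mul1r lerBlDr.
  rewrite -[leLHS](congr1 Num.norm (subrK (B y) y)) addrC.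
  by rewrite (le_trans (ler_normD _ _))// lerD.
have Binj y z : B y = B z -> y = z.
  move=> yz; apply/eqP; rewrite -subr_eq0 -normr_le0 (le_trans (lower _))//.
  by rewrite BB yz subrr normr0 mulr0.
have Bsurj z : exists y, B y = z.
  pose r := (1 - q)^-1 * `|z|.
  have r0 : 0 <= r by rewrite mulr_ge0// invr_ge0 ltW.
  have zr : `|z| = (1 - q) * r by rewrite /r mulrA mulfV ?mul1r// gt_eqF.
  have [||y _ yE] :=
    @contraction_closed_ball R Y (fun y => y - B y + z) r q r0 q0 q1.
  - move=> y yr; rewrite (le_trans (ler_normD _ _))// zr.
    have := Bq y; nra.
  - move=> y y' _ _; apply: le_trans (Bq _); rewrite BB /=.
    rewrite (opprD _ z) addrACA subrr addr0.
    by rewrite !opprD !opprK addrACA.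
  - exists y; apply/esym/eqP; rewrite -subr_eq0; apply/eqP.
    by apply: (addrI y); rewrite addr0 -[RHS]yE addrA addrAC.
have [S SP] := choice Bsurj.
have Slin : linear S.
  move=> k y z; apply: Binj; rewrite SP.
  by rewrite [B _](linearP B') /= !SP.
have SM y : `|S y| <= (1 - q)^-1 * `|y| by rewrite -{2}(SP y).
have [T TE] := bounded_linear_blin Slin SM.
exists T; rewrite TE; split => // y.
by apply: Binj; rewrite SP.
Qed.

(** * Zeros along the image of the right inverse *)

Lemma ball_segment (R : realType) (V : normedModType R) (x a b : V) (r t : R) :
  ball x r a -> ball x r b -> 0 <= t <= 1 -> ball x r (a + t *: (b - a)).
Proof.
rewrite -ball_normE /ball_ /= => xa xb /andP[t0 t1].
have -> : x - (a + t *: (b - a)) = (1 - t) *: (x - a) + t *: (x - b).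
  rewrite scalerBl scale1r -addrA -scalerN -scalerDr opprD addrA.
  by rewrite -scalerN !opprB addrA subrK.
rewrite (le_lt_trans (ler_normD _ _))// !normrZ !ger0_norm ?subr_ge0//.
have m_lt : Num.max `|x - a| `|x - b| < r by rewrite gt_max xa.
apply: le_lt_trans m_lt; set m := Num.max _ _.
have -> : m = (1 - t) * m + t * m by rewrite -mulrDl subrK mul1r.
by rewrite lerD// ler_wpM2l ?subr_ge0// le_max lexx ?orbT.
Qed.

Section NewtonPicardMap.
Context {R : realType} {X Y : completeNormedModType R}.
Variables (f : X -> Y) (x0 : X) (D : blin X Y) (Q : blin Y X) (c delta : R).
Hypothesis c_gt0 : 0 < c.
Hypothesis delta_gt0 : 0 < delta.
Hypothesis DQ : forall y, D (Q y) = y.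
Hypothesis Qc : forall y, `|Q y| <= c * `|y|.
Hypothesis fdiff : forall x, ball x0 delta x -> differentiable f x.
Hypothesis fD : forall x, ball x0 delta x ->
  forall v, `|'d f x v - D v| <= (4 * c)^-1 * `|v|.

Let c_ge0 : 0 <= c := ltW c_gt0.

Let c4_ge0 : 0 <= (4 * c)^-1.
Proof. by rewrite invr_ge0 mulr_ge0. Qed.

Let c_inv : c * (4 * c)^-1 = 4^-1.
Proof. by rewrite invfM mulrCA mulfV ?mulr1// gt_eqF. Qed.

Lemma almost_linear a b : ball x0 delta a -> ball x0 delta b ->
  `|f b - f a - D (b - a)| <= (4 * c)^-1 * `|b - a|.
Proof.
move=> xa xb; apply: diff_mean_value => t t01.
have xt := ball_segment xa xb t01.
by split; [exact: fdiff|exact: fD].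
Qed.

(** Applying D to the displacement h + Q k gives D h + k, which [almost_linear]
    compares with the increment of f; the error is at most
    |h| / (4c) + |k| / 4, and its second part is absorbed on the left.  With
    h = 0 this bounds the Newton correction, and with f z = f z' = 0 it makes N
    Lipschitz. *)
Lemma image_displacement z z' h k : ball x0 delta z -> ball x0 delta z' ->
  z' - z = h + Q k ->
  `|k| <= 2 * (`|f z' - f z| + (opnorm D + (4 * c)^-1) * `|h|).
Proof.
move=> xz xz' zz'.
have := almost_linear xz xz'; rewrite zz' linearD /= DQ => al.
have hQk : (4 * c)^-1 * `|h + Q k| <= (4 * c)^-1 * `|h| + 4^-1 * `|k|.
  rewrite -c_inv [c * _]mulrC -mulrA -mulrDr ler_wpM2l//.
  by rewrite (le_trans (ler_normD _ _))// lerD.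
have kE F : k = F - D h - (F - (D h + k)).
  by rewrite opprB [RHS]addrC addrA subrK addrAC subrr add0r.
have := ler_normB ((f z' - f z) - D h) (f z' - f z - (D h + k)).
rewrite -kE => hk.
have := ler_normB (f z' - f z) (D h).
have := opnorm_ub D h.
have := normr_ge0 k; have := normr_ge0 (f z' - f z).
move: hk al hQk; lra.
Qed.

(** Banach's fixed point theorem for T y = y - f (x1 + Q y) on the closed ball
    of radius r = delta / (2c): T is 1/4-Lipschitz, and |T 0| = |f x1| < r / 2.
    The points x1 + Q y stay in the delta-ball as delta / 8 + c r < delta. *)
Lemma newton_zero x1 : newton_dom f x0 c delta x1 ->
  exists y, f (x1 + Q y) = 0 /\ ball x0 delta (x1 + Q y).
Proof.
rewrite /newton_dom /= -ball_normE /ball_ /= => -[x01 fx1].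
pose r := delta / (2 * c).
have r0 : 0 <= r by rewrite divr_ge0 ?mulr_ge0 ?ltW.
have cr : c * r = delta / 2.
  by rewrite /r invfM mulrCA [c * _]mulrCA mulfV ?mulr1// gt_eqF.
have fr : `|f x1| < r / 2.
  by rewrite /r -mulrA -invfM mulrAC -natrM.
have inball y : `|y| <= r -> ball x0 delta (x1 + Q y).
  move=> yr; rewrite -ball_normE /ball_ /= opprD addrA.
  rewrite (le_lt_trans (ler_normB _ _))//.
  have := ler_wpM2l c_ge0 yr; rewrite cr => /(le_trans (Qc y))/(ltr_leD x01).
  by move=> /lt_le_trans; apply; move: delta_gt0; lra.
pose T y := y - f (x1 + Q y).
have Tlip y z : `|y| <= r -> `|z| <= r -> `|T y - T z| <= 4^-1 * `|y - z|.
  move=> yr zr; have := almost_linear (inball _ zr) (inball _ yr).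
  have -> : x1 + Q y - (x1 + Q z) = Q (y - z).
    by rewrite linearB /= opprD addrACA subrr add0r.
  rewrite DQ distrC => al.
  have -> : T y - T z = y - z - (f (x1 + Q y) - f (x1 + Q z)).
    by rewrite /T !opprD !opprK addrACA.
  by rewrite (le_trans al)// -c_inv [c * _]mulrC -mulrA ler_wpM2l.
have [||||y yr Ty] := @contraction_closed_ball R Y T r 4^-1 r0.
- lra.
- lra.
- move=> y yr.
  have := Tlip y 0 yr; rewrite normr0 subr0 => /(_ r0).
  rewrite {2}/T linear0 addr0 sub0r opprK => Ty.
  rewrite -[T y](addrK (f x1)) (le_trans (ler_normB _ _))//; lra.
- exact: Tlip.
- exists y; split; last by have := inball y yr; rewrite -ball_normE.
  by apply/eqP; rewrite -oppr_eq0; apply/eqP/(addrI y); rewrite addr0.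
Qed.

(** * The differential of the Newton-Picard map *)

Local Notation N := (newton_picard f x0 Q delta).

Lemma newton_picardP x1 : newton_dom f x0 c delta x1 ->
  exists y, [/\ N x1 = x1 + Q y, f (N x1) = 0 & ball x0 delta (N x1)].
Proof.
move=> /newton_zero[y [fy xy]].
have : [set x | [/\ f x = 0, range Q (x - x1) & `|x - x0| < delta]] (N x1).
  apply: (xgetPex x1); exists (x1 + Q y); split => //.
    by exists y => //; rewrite addrC addKr.
  by move: xy; rewrite -ball_normE /ball_ /= distrC.
move=> [fN [y' _ Qy'] xN]; exists y'; split => //.
  by rewrite Qy' addrC subrK.
by rewrite -ball_normE /ball_ /= distrC.
Qed.

Lemma newton_dom_ball x1 : newton_dom f x0 c delta x1 -> ball x0 delta x1.
Proof. by move=> [+ _]; apply: le_ball; move: delta_gt0; lra. Qed.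

Lemma newton_picard_dist x1 : newton_dom f x0 c delta x1 ->
  `|N x1 - x1| <= 2 * c * `|f x1|.
Proof.
move=> x1dom; have [y [NE fN xN]] := newton_picardP x1dom.
have := @image_displacement x1 (N x1) 0 y (newton_dom_ball x1dom) xN.
rewrite fN sub0r normrN normr0 mulr0 addr0 add0r NE addrC addKr => /(_ erefl).
move=> /(ler_wpM2l c_ge0) /(le_trans (Qc y)).
by rewrite mulrCA mulrA.
Qed.

Lemma newton_dom_near x1 : newton_dom f x0 c delta x1 ->
  exists2 d, 0 < d & forall h, `|h| < d -> newton_dom f x0 c delta (x1 + h).
Proof.
move=> x1dom; have fx1 := fdiff (newton_dom_ball x1dom).
have : nbhs x1 (newton_dom f x0 c delta).
  apply: filterI.
    by apply: open_nbhs_nbhs; split; [exact: ball_open|case: x1dom].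
  have /cvgr_norm_lt := differentiable_continuous fx1.
  by apply; case: x1dom.
move=> /nbhs_normP[d /= d0 dP]; exists d => // h hd.
by apply: dP; rewrite /= opprD addNKr normrN.
Qed.

(** Set N (x1 + h) - N x1 = h + Q k, where |k| <= L |h|.  Expanding f to first
    order at N x1 between the two zeros of f gives A h + A Q k = o(h); applying
    S gives k = - S A h + o(h), so the increment of N is h - Q S A h + o(h). *)
Lemma newton_picard_differential x1 : newton_dom f x0 c delta x1 ->
  exists S : blin Y Y, (forall y, `|S y| <= 2 * `|y|) /\
    forall xi, 'd N x1 xi = xi - Q (S ('d f (N x1) xi)).
Proof.
move=> x1dom; have [y [NE fN xN]] := newton_picardP x1dom.
set A := 'd f (N x1).
have AQlin : linear (A \o Q) by move=> k u v; rewrite /= !linearP.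
have [||| S [_ SAQ SM]] := near_identity_inverse (q := 4^-1) AQlin.
- lra.
- lra.
- move=> z /=; rewrite -{1}(DQ z) distrC (le_trans (fD xN _))//.
  by rewrite -c_inv [c * _]mulrC -mulrA ler_wpM2l.
have {}SM z : `|S z| <= 2 * `|z|.
  by rewrite (le_trans (SM z))// ler_wpM2r// invf_ple ?posrE; lra.
exists S; split => // xi.
pose M := opnorm D + (4 * c)^-1.
have AM v : `|A v| <= M * `|v|.
  rewrite -[A v](subrK (D v)) addrC (le_trans (ler_normD _ _))// mulrDl lerD//.
    exact: opnorm_ub.
  exact: fD.
pose g v := v - Q (S (A v)).
have glin : linear g.
  move=> k u v; rewrite /g (linearP A) (linearP S) (linearP Q) /=.
  by rewrite scalerBr opprD addrACA.
have gM v : `|g v| <= (1 + c * (2 * M)) * `|v|.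
  rewrite (le_trans (ler_normB _ _))// mulrDl mul1r lerD// (le_trans (Qc _))//.
  rewrite -!mulrA ler_wpM2l// (le_trans (SM _))// ?ler_wpM2l//.
have [G GE] := bounded_linear_blin glin gM.
rewrite -/(g xi) -GE; congr (_ xi).
apply: expansion_diff => e e0; rewrite GE.
pose L := 2 * M.
have L0 : 0 <= L.
  by rewrite mulr_ge0// addr_ge0 ?opnorm_ge0.
have cL : 0 < 1 + c * L by rewrite ltr_wpDr// mulr_ge0.
(* The factors of the denominator are the losses from S (2), from Q (c), and
   from passing from |h + Q k| to |h|. *)
pose e' := e / (2 * c * (1 + c * L)).
have e'0 : 0 < e' by rewrite divr_gt0// !mulr_gt0.
have [d d0 dP] := diff_expansion (fdiff xN) e'0.
have [d' d'0 d'P] := newton_dom_near x1dom.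
exists (Num.min d' (d / (1 + c * L))); first by rewrite lt_min d'0 divr_gt0.
move=> h; rewrite lt_min ltr_pdivlMr// => /andP[hd' hd].
have [y' [NE' fN' xN']] := newton_picardP (d'P h hd').
pose k := y' - y.
have NN : N (x1 + h) - N x1 = h + Q k.
  rewrite NE' NE /k linearB /=.
  by rewrite opprD addrACA [x1 + h]addrC addrK.
move: k NN => k NN.
have kL : `|k| <= L * `|h|.
  have := image_displacement xN xN' NN.
  by rewrite fN fN' subrr normr0 add0r mulrA.
have hk : `|h + Q k| <= (1 + c * L) * `|h|.
  rewrite (le_trans (ler_normD _ _))// mulrDl mul1r lerD// (le_trans (Qc _))//.
  by rewrite -mulrA ler_wpM2l.
have step : N x1 + (h + Q k) = N (x1 + h) by rewrite -NN addrC subrK.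
have := dP (h + Q k); rewrite step fN fN' subrr sub0r normrN -/A.
rewrite mulrC in hd; move=> /(_ (le_lt_trans hk hd)).
move=> /le_trans/(_ (ler_wpM2l (ltW e'0) hk)) Ahk.
have -> : N (x1 + h) - N x1 - g h = Q (S (A (h + Q k))).
  rewrite NN (linearD A) (linearD S) (linearD Q) /= [S (A (Q k))]SAQ.
  by rewrite /g opprB addrC addrA subrK.
rewrite (le_trans (Qc _))//.
have cc := ler_wpM2l c_ge0.
rewrite (le_trans (cc _ _ (SM _)))//.
rewrite (le_trans (cc _ _ (ler_wpM2l _ Ahk)))// /e'.
rewrite le_eqVlt; apply/orP; left; apply/eqP; field.
by rewrite !gt_eqF.
Qed.

End NewtonPicardMap.

(** * The tangent map estimate *)

Theorem theoremB12 (R : realType) (delta c c2 : R)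
    (delta_gt0 : 0 < delta) (c_gt0 : 0 < c) (c2_gt0 : 0 < c2)
    (hatdelta01 : 0 < Num.min delta (4 * c * c2)^-1 < 1) :
  exists C : R -> R -> R,
  forall (X Y : completeNormedModType R) (U : set X) (f : X -> Y) (x0 : X)
    (Q : blin Y X),
    open U -> C2_on U f -> U x0 ->
    (forall y, exists x, bdiff f x0 x = y) ->
    (forall y, bdiff f x0 (Q y) = y) ->
    `|Q| <= c ->
    ball x0 delta `<=` U ->
    (forall x, ball x0 delta x ->
       `|bdiff f x - bdiff f x0| <= (4 * c)^-1 /\
       `|bdiff (bdiff f) x| <= c2) ->
    forall W1 : X * X, newton_dom f x0 c delta W1.1 ->
      `|tangent_map (newton_picard f x0 Q delta) W1 - W1| <=
        C `|W1.2| (opnorm (newton_picard_diff0 f x0 Q)) *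
        `|tangent_map f W1| * (1 + `|tangent_map f W1|).
Proof.
exists (fun xi _ => 2 * c * (1 + 2 * c * c2 * xi)).
move=> X Y U f x0 Q _ [fdiff dfdiff _] _ _ DQ Qc0 BU fB [x1 xi] /= x1dom.
have fd x : ball x0 delta x -> differentiable f x by move=> /BU/fdiff.
have Qc y : `|Q y| <= c * `|y|.
  by rewrite (le_trans (opnorm_ub Q y))// ler_wpM2r.
have fD x : ball x0 delta x ->
    forall v, `|'d f x v - bdiff f x0 v| <= (4 * c)^-1 * `|v|.
  move=> xB v; rewrite -(bdiffE (fd x xB)).
  rewrite (le_trans (opnorm_ub (bdiff f x - bdiff f x0) v))// ler_wpM2r//.
  by have [] := fB x xB.
have [y [_ fN xN]] := newton_picardP c_gt0 delta_gt0 DQ Qc fd fD x1dom.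
have dist := newton_picard_dist c_gt0 delta_gt0 DQ Qc fd fD x1dom.
have [S [SM dN]] :=
  newton_picard_differential c_gt0 delta_gt0 DQ Qc fd fD x1dom.
have x1B := newton_dom_ball delta_gt0 x1dom.
rewrite /tangent_map /= dN.
set N := newton_picard f x0 Q delta x1 in fN xN dist *.
have dfN : `|'d f N xi - 'd f x1 xi| <= 2 * c * c2 * `|xi| * `|f x1|.
  have -> : 2 * c * c2 * `|xi| * `|f x1| = c2 * (2 * c * `|f x1|) * `|xi|.
    by ring.
  rewrite -(bdiffE (fd _ xN)) -(bdiffE (fd _ x1B)).
  rewrite (le_trans (opnorm_ub (bdiff f N - bdiff f x1) xi))// ler_wpM2r//.
  apply: (@le_trans _ _ (c2 * `|N - x1|)); last by rewrite ler_wpM2l// ltW.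
  rewrite -blin_normE -[X in `|X|]subr0.
  apply: (@diff_mean_value _ _ _ (bdiff f) \0 x1 N c2) => t t01.
  have xt := ball_segment x1B xN t01; have dt := dfdiff _ (BU _ xt).
  split => // v; rewrite subr0 -(bdiffE dt).
  rewrite (le_trans (opnorm_ub _ _))// ler_wpM2r//.
  by have [] := fB _ xt.
rewrite [leLHS]prod_normE [`|(f x1, _)|]prod_normE /=.
set m := Num.max `|f x1| `|'d f x1 xi|.
have fm : `|f x1| <= m by rewrite le_max lexx.
have dm : `|'d f x1 xi| <= m by rewrite le_max lexx orbT.
have m0 : 0 <= m by exact: le_trans fm.
have K0 : 0 <= 2 * c * c2 * `|xi| by rewrite !mulr_ge0// ltW.
move: (2 * c * c2 * `|xi|) K0 dfN => K K0 dfN.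
have bound : Num.max `|N - x1| `|xi - Q (S ('d f N xi)) - xi| <=
    2 * c * (1 + K) * m.
  rewrite ge_max; apply/andP; split.
    rewrite (le_trans dist)// -!mulrA ler_wpM2l// ler_wpM2l ?(ltW c_gt0)//.
    by rewrite mulrDl mul1r (le_trans fm)// lerDl mulr_ge0.
  rewrite addrAC subrr sub0r normrN (le_trans (Qc _))//.
  rewrite [2 * c]mulrC -!mulrA ler_wpM2l ?(ltW c_gt0)//.
  rewrite (le_trans (SM _))// ler_wpM2l//.
  rewrite -['d f N xi](subrK ('d f x1 xi)) (le_trans (ler_normD _ _))//.
  by rewrite addrC mulrDl mul1r lerD// (le_trans dfN)// ler_wpM2l.
by rewrite (le_trans bound)// ler_peMr ?lerDl// !mulr_ge0 ?addr_ge0// ltW.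
Qed.
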